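(* Let $f$ satisfy $(\mathcal A)$, let $t_0>0$, $q\ge\frac12$, $p\ge1$. Let $y:[t_0,+\infty[\to\mathcal H$ be continuously differentiable and $\lambda:[t_0,+\infty[\to\,]0,+\infty[$ continuous such that, with $\tau(t)=\frac{1}{q^q}\big(t_0+\int_{t_0}^t[\lambda(r)]^{1/q}dr\big)^q$, for all $t\ge t_0$: $$\dot y(t)+\dot\tau(t)\nabla f(y(t))=0,\qquad [\lambda(t)]^p\|\nabla f(y(t))\|^{p-1}=1 .$$ Then, as $t\to+\infty$: (i) $f(y(t))-\inf_{\mathcal H}f=o(t^{-pq})$; (ii) $\|\nabla f(y(t))\|=o(t^{-pq})$; (iii) $\int_{t_0}^{+\infty}t^{pq(2-\frac1q)}\|\nabla f(y(t))\|^{2+\frac{p-1}{pq}}\,dt<+\infty$; (iv) $y(t)$ converges weakly as $t\to+\infty$ to an element of $S=\operatorname{argmin} f$.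
   Context: $\mathcal H$ is a real Hilbert space. Assumption $(\mathcal A)$: $f:\mathcal H\to\mathbb R$ is convex and continuously differentiable, $S=\operatorname{argmin}_{\mathcal H} f\neq\emptyset$, and $\nabla f$ is Lipschitz continuous on bounded subsets of $\mathcal H$. *)

(* Defs.v *)
From HB Require Import structures.
From mathcomp Require Import all_boot all_order all_algebra.
From mathcomp Require Import all_classical all_reals all_analysis.
Set Implicit Arguments. Unset Strict Implicit. Unset Printing Implicit Defensive.
Import Order.TTheory GRing.Theory Num.Theory.
Import numFieldNormedType.Exports.
Local Open Scope classical_set_scope.
Local Open Scope ring_scope.

(* A real Hilbert space: a complete normed space H over the reals whose norm
   is induced by the (symmetric, bilinear) inner product [ip]. *)
Definition is_inner_product (R : realType) (H : normedModType R)
  (ip : H -> H -> R) : Prop :=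
  (forall x y : H, ip x y = ip y x) /\
  (forall (a : R) (x y z : H), ip (a *: x + y) z = a * ip x z + ip y z) /\
  (forall x : H, `|x| ^+ 2 = ip x x).

Definition convex_fun (R : realType) (H : normedModType R) (f : H -> R) : Prop :=
  forall (x y : H) (t : R), 0 <= t <= 1 ->
    f (t *: x + (1 - t) *: y) <= t * f x + (1 - t) * f y.

Definition assumption_A (R : realType) (H : completeNormedModType R)
  (ip : H -> H -> R) (f : H -> R) (gf : H -> H) : Prop :=
  [/\ convex_fun f,
      (forall x : H, differentiable f x /\ forall h : H, 'd f x h = ip (gf x) h),
      continuous gf,
      (exists xs : H, forall z : H, f xs <= f z) &
      (forall B : set H, (exists M : R, forall x, B x -> `|x| <= M) ->
         exists L : R, forall x y, B x -> B y -> `|gf x - gf y| <= L * `|x - y|)].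

Definition argmin (R : realType) (H : normedModType R) (f : H -> R) : set H :=
  [set xs | forall z, f xs <= f z].

Definition weak_cvg_pinfty (R : realType) (H : normedModType R)
  (ip : H -> H -> R) (y : R -> H) (x : H) : Prop :=
  forall h : H, (fun t => ip (y t) h) @ +oo --> ip x h.

Definition tau (R : realType) (t0 q : R) (lam : R -> R) (t : R) : R :=
  (q `^ q)^-1 * (t0 + Rintegral lebesgue_measure `[t0, t] (fun r => lam r `^ q^-1)) `^ q.

(* Main.v *)
(** In the time scale [tau] the trajectory is a steepest descent flow, so
    [1/2 |y - x*|^2] and [E = tau (f(y) - min f) + 1/2 |y - x*|^2] decrease, with
    [E' <= - tau tau' |grad f(y)|^2], and [|grad f(y)|] decreases as well.
    Comparing increments of [tau] and [tau^2 / 2] with those of these Lyapunov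
    functions gives [f(y) - min f = o(1/tau)] and [|grad f(y)| = o(1/tau)].  With
    [u = q tau^(1/q)], the feedback law turns the bound [|grad f(y)| <= K / tau]
    into [u' >= k u^(1 - 1/p)], hence [tau >= c t^(pq)], which converts the rates
    in [tau] into rates in [t].  Weak convergence is Opial's lemma, proved with
    asymptotic centers (minimizers of [limsup |y - x|^2]) instead of weak
    compactness. *)

Require Import Defs.
From HB Require Import structures.
From mathcomp Require Import all_boot all_order all_algebra.
From mathcomp Require Import all_classical all_reals all_analysis.
From mathcomp Require Import ring lra.
Set Implicit Arguments. Unset Strict Implicit. Unset Printing Implicit Defensive.
Import Order.TTheory GRing.Theory Num.Theory.
Import numFieldNormedType.Exports.
Local Open Scope classical_set_scope.
Local Open Scope ring_scope.

(** * Inner products *)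

Section InnerProduct.
Context (R : realType) (H : normedModType R) (ip : H -> H -> R).
Hypothesis ipP : is_inner_product ip.

Lemma ipC x y : ip x y = ip y x.
Proof. by have [] := ipP. Qed.

Lemma ip_norm x : ip x x = `|x| ^+ 2.
Proof. by have [_ []] := ipP. Qed.

Lemma ip0l z : ip 0 z = 0.
Proof.
have [_ [L _]] := ipP; have := L 1 0 0 z.
by rewrite scaler0 addr0; lra.
Qed.

Lemma ipDl x y z : ip (x + y) z = ip x z + ip y z.
Proof. by have [_ [L _]] := ipP; have := L 1 x y z; rewrite scale1r mul1r. Qed.

Lemma ipZl a x z : ip (a *: x) z = a * ip x z.
Proof. by have [_ [L _]] := ipP; have := L a x 0 z; rewrite addr0 ip0l addr0. Qed.

Lemma ipNl x z : ip (- x) z = - ip x z.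
Proof. by rewrite -scaleN1r ipZl mulN1r. Qed.

Lemma ipBl x y z : ip (x - y) z = ip x z - ip y z.
Proof. by rewrite ipDl ipNl. Qed.

Lemma ipDr x y z : ip x (y + z) = ip x y + ip x z.
Proof. by rewrite ipC ipDl !(ipC _ x). Qed.

Lemma ipZr a x z : ip x (a *: z) = a * ip x z.
Proof. by rewrite ipC ipZl ipC. Qed.

Lemma ipNr x z : ip x (- z) = - ip x z.
Proof. by rewrite ipC ipNl ipC. Qed.

Lemma ipBr x y z : ip x (y - z) = ip x y - ip x z.
Proof. by rewrite ipDr ipNr. Qed.

Definition ipE := (ipDl, ipDr, ipNl, ipNr, ipZl, ipZr).

(** Expanding the squared norm of [|y| x - |x| y] leaves [2 |x| |y| (|x| |y| - ip x y) >= 0]; the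
    positive factor cancels when both vectors are nonzero. *)
Lemma cauchy_schwarz x y : ip x y <= `|x| * `|y|.
Proof.
have [->|x0] := eqVneq x 0; first by rewrite ip0l normr0 mul0r.
have [->|y0] := eqVneq y 0; first by rewrite ipC ip0l normr0 mulr0.
have xp : 0 < `|x| by rewrite normr_gt0.
have yp : 0 < `|y| by rewrite normr_gt0.
have := sqr_ge0 `| `|y| *: x - `|x| *: y|.
rewrite -ip_norm !ipE !ip_norm (ipC y x) => h.
have : 0 <= (2 * (`|x| * `|y|)) * (`|x| * `|y| - ip x y) by nra.
by rewrite pmulr_rge0 ?subr_ge0// !mulr_gt0.
Qed.

(** Polarization writes [ip] through norms, so joint continuity comes from that of the norm. *)
Lemma cvg_ip (T : Type) (F : set_system T) (FF : Filter F) (u v : T -> H) a b :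
  u @ F --> a -> v @ F --> b -> (fun t => ip (u t) (v t)) @ F --> ip a b.
Proof.
have polar x y : ip x y = 2^-1 * (`|x + y| * `|x + y| - `|x| * `|x| - `|y| * `|y|).
  by rewrite -!expr2 -!ip_norm !ipE (ipC y x); field.
move=> ua vb.
under eq_fun do rewrite polar.
rewrite polar.
have nuv : (fun t => `|u t + v t|) @ F --> `|a + b| by apply: cvg_norm; exact: cvgD.
have nu : (fun t => `|u t|) @ F --> `|a| by exact: cvg_norm.
have nv : (fun t => `|v t|) @ F --> `|b| by exact: cvg_norm.
apply: cvgM; first exact: cvg_cst.
by apply: cvgB; [apply: cvgB|]; apply: cvgM.
Qed.

End InnerProduct.

(** * Asymptotic centers *)

Section AsymptoticCenter.
Context (R : realType) (H : completeNormedModType R) (ip : H -> H -> R).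
Hypothesis ipP : is_inner_product ip.
Context (T : Type) (F : set_system T) (FF : ProperFilter F) (y : T -> H).

(** This is the limsup of [|y t - x|^2] along [F], written as the infimum of the eventual upper
    bounds. A general filter is allowed so that it can later be restricted to a set of times. *)
Definition asymptotic_sqradius (x : H) : R :=
  inf [set a | \forall t \near F, `|y t - x| ^+ 2 <= a].

Local Notation phi := asymptotic_sqradius.

Hypothesis y_bnd : exists M, \forall t \near F, `|y t| <= M.

Lemma asymptotic_sqradius_le x a :
  (\forall t \near F, `|y t - x| ^+ 2 <= a) -> phi x <= a.
Proof.
move=> Fa; apply: ge_inf => //; exists 0 => b Fb.
by have [t] := filter_ex Fb; apply: le_trans; exact: sqr_ge0.
Qed.

Let sqradius_bounds_neq0 x :
  [set a | \forall t \near F, `|y t - x| ^+ 2 <= a] !=set0.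
Proof.
have [M FM] := y_bnd; exists ((M + `|x|) ^+ 2) => /=.
near=> t; rewrite ler_sqr ?nnegrE// ?(le_trans (ler_normB _ _))//.
  by rewrite lerD2r; near: t.
by rewrite (@le_trans _ _ (`|y t| + `|x|)) ?addr_ge0// lerD2r; near: t.
Unshelve. all: by end_near. Qed.

Lemma asymptotic_sqradius_ge x a :
  (\forall t \near F, a <= `|y t - x| ^+ 2) -> a <= phi x.
Proof.
move=> Fa; apply: lb_le_inf (sqradius_bounds_neq0 x) _ => b Fb.
have [t [h1 h2]] := filter_ex (filterI Fa Fb).
exact: le_trans h1 h2.
Qed.

Lemma asymptotic_sqradius_near x a :
  phi x < a -> \forall t \near F, `|y t - x| ^+ 2 <= a.
Proof.
move=> xa; apply: contrapT => nF.
suff : a <= phi x by rewrite leNgt xa.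
apply: lb_le_inf (sqradius_bounds_neq0 x) _ => b Fb.
rewrite leNgt; apply/negP => ba; apply: nF.
by apply: filterS Fb => t /le_trans; apply; exact: ltW.
Qed.

Lemma asymptotic_sqradius_cvg x l :
  (fun t => `|y t - x| ^+ 2) @ F --> l -> phi x = l.
Proof.
move=> yl; apply/eqP; rewrite eq_le; apply/andP; split.
- apply/ler_addgt0Pr => e e0; apply: asymptotic_sqradius_le.
  have /cvgrPdist_le/(_ _ e0) := yl; apply: filterS => t.
  by rewrite ler_norml => /andP[]; lra.
- apply/ler_addgt0Pr => e e0; rewrite -lerBlDr; apply: asymptotic_sqradius_ge.
  have /cvgrPdist_le/(_ _ e0) := yl; apply: filterS => t.
  by rewrite ler_norml => /andP[]; lra.
Qed.

(** The parallelogram identity passes to the limsup; the negative term makes minimizing sequences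
    Cauchy. *)
Lemma asymptotic_sqradius_mid x z :
  phi (2^-1 *: (x + z)) <= 2^-1 * phi x + 2^-1 * phi z - 4^-1 * `|x - z| ^+ 2.
Proof.
apply/ler_addgt0Pr => e e0; apply: asymptotic_sqradius_le.
have /asymptotic_sqradius_near hx : phi x < phi x + e by rewrite ltrDl.
have /asymptotic_sqradius_near hz : phi z < phi z + e by rewrite ltrDl.
near=> t.
have : `|y t - x| ^+ 2 <= phi x + e by near: t.
have : `|y t - z| ^+ 2 <= phi z + e by near: t.
have -> : `|y t - 2^-1 *: (x + z)| ^+ 2 =
    2^-1 * `|y t - x| ^+ 2 + 2^-1 * `|y t - z| ^+ 2 - 4^-1 * `|x - z| ^+ 2.
  by rewrite -!(ip_norm ipP) !(ipE ipP) !(ipC ipP _ (y t)) (ipC ipP z x); field.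
lra.
Unshelve. all: by end_near. Qed.

(** Completeness does the work of compactness: a minimizing sequence is Cauchy by the midpoint
    inequality, and its limit is a minimizer. *)
Lemma asymptotic_center : exists c, forall x, phi c <= phi x.
Proof.
pose m := inf (range phi).
have phi_ge0 x : 0 <= phi x.
  by apply: asymptotic_sqradius_ge; apply: nearW => t; exact: sqr_ge0.
have m_le x : m <= phi x.
  by apply: ge_inf; [exists 0 => _ [z _ <-]|exists x].
have has_inf_phi : has_inf (range phi).
  by split; [exists (phi 0), 0|exists 0 => _ [z _ <-]].
have /choice[x xP] : forall n, exists x, phi x < m + n.+1%:R^-1.
  move=> n; have n0 : 0 < n.+1%:R^-1 :> R by rewrite invr_gt0 ltr0n.
  by have [_ [x _ <-] ?] := inf_adherent n0 has_inf_phi; exists x.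
have inv_small e : 0 < e -> \forall n \near \oo, n.+1%:R^-1 < e :> R.
  move=> e0; have := @near_infty_natSinv_lt R (PosNum e0).
  by [].
(* The midpoint has value at least [m], while both endpoints are within [1/(n+1)] and [1/(k+1)] of
   [m]. *)
have xdist n k : `|x n - x k| ^+ 2 <= 2 * n.+1%:R^-1 + 2 * k.+1%:R^-1.
  have := asymptotic_sqradius_mid (x n) (x k).
  have := m_le (2^-1 *: (x n + x k)); have := xP n; have := xP k.
  move: n.+1%:R^-1 k.+1%:R^-1 => a b; lra.
have xcvg : cvg (x @ \oo).
  apply: cauchy_cvg; apply: cauchy_exP => e e0.
  have e4 : 0 < e ^+ 2 / 4 by rewrite divr_gt0// exprn_gt0.
  have [N _ NP] := inv_small _ e4.
  exists (x N).
  suff : \forall n \near \oo, ball (x N) e (x n) by [].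
  near=> n; rewrite -ball_normE /=.
  rewrite -ltr_sqr ?nnegrE ?(ltW e0)//.
  apply: le_lt_trans (xdist _ _) _.
  have hN : N.+1%:R^-1 < e ^+ 2 / 4 by apply: NP => /=.
  have hn : n.+1%:R^-1 < e ^+ 2 / 4 by near: n; exact: inv_small.
  move: (N.+1%:R^-1) (n.+1%:R^-1) hN hn => a b; lra.
exists (lim (x @ \oo)) => z; apply: le_trans (m_le z).
set c := lim _; apply/ler_addgt0Pr => e e0.
have [M FM] := y_bnd.
(* [K] eventually bounds [|y t - x n|]. Replacing [x n] by [c] then costs at most
   [|c - x n| (2 K + 1) <= e / 2] in the square; the other two errors are [e / 4] each. *)
pose K := `|M| + `|c| + 1.
have K0 : 0 < K by rewrite /K ltr_pwDr// addr_ge0.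
have d0 : 0 < Num.min 1 (e / 2 / (2 * K + 1)).
  by rewrite lt_min ltr01 /= divr_gt0// ?divr_gt0// ltr_wpDl// mulr_ge0// ltW.
near \oo => n.
have xc : `|c - x n| < Num.min 1 (e / 2 / (2 * K + 1)).
  by near: n; have /cvgrPdist_lt := xcvg; apply.
have n_small : n.+1%:R^-1 < e / 4 :> R.
  by near: n; apply: inv_small; rewrite divr_gt0.
apply: asymptotic_sqradius_le.
have e4 : phi (x n) < phi (x n) + e / 4 by rewrite ltrDl divr_gt0.
have Fx := asymptotic_sqradius_near e4.
near=> t.
have h1 : `|y t - x n| ^+ 2 <= phi (x n) + e / 4 by near: t.
have h2 : `|y t| <= M by near: t.
move: xc; rewrite lt_min => /andP[xc1 xc2].
have h3 : `|x n| <= `|c| + 1.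
  have := lerB_dist (x n) c; rewrite distrC; lra.
have h4 : `|y t - x n| <= K.
  by rewrite /K (le_trans (ler_normB _ _))// -addrA lerD// (le_trans h2)// ler_norm.
have h5 : `|y t - c| <= `|y t - x n| + `|c - x n|.
  by rewrite (distrC c) -[y t - c](subrKA (x n)) ler_normD.
have h6 : `|c - x n| * (2 * K + 1) <= e / 2.
  by rewrite -ler_pdivlMr ?(ltW xc2)// ltr_wpDl// mulr_ge0// ltW.
have h7 : phi (x n) < m + e / 4 by apply: lt_trans (xP n) _; rewrite ltrD2l.
have a0 := normr_ge0 (c - x n); have b0 := normr_ge0 (y t - x n).
have : `|y t - c| ^+ 2 <= (`|y t - x n| + `|c - x n|) ^+ 2.
  by rewrite ler_sqr ?nnegrE// addr_ge0.
nra.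
Unshelve. all: by end_near. Qed.

(* Moving the center by a small multiple of [h] would decrease the radius. *)
Lemma asymptotic_center_ip c h d : (forall x, phi c <= phi x) ->
  0 < d -> ~ \forall t \near F, d <= ip (y t - c) h.
Proof.
move=> cmin d0 Fd.
have h0 : h != 0.
  apply/eqP => h0; have [t] := filter_ex Fd.
  by rewrite h0 (ipC ipP) (ip0l ipP) leNgt d0.
have hp : 0 < `|h| ^+ 2 by rewrite exprn_gt0// normr_gt0.
(* This step size minimizes [- 2 s d + s^2 |h|^2], a gain of [s d]; half of it absorbs the slack in
   the limsup. *)
pose s := d / `|h| ^+ 2.
have s0 : 0 < s by rewrite divr_gt0.
have hs : s * `|h| ^+ 2 = d by rewrite /s -mulrA mulVf ?mulr1// gt_eqF.
have := cmin (c + s *: h); apply/negP; rewrite -ltNge.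
have sd : 0 < s * d by rewrite mulr_gt0.
suff : phi (c + s *: h) <= phi c - s * d / 2 by lra.
apply: asymptotic_sqradius_le.
have /asymptotic_sqradius_near Fc : phi c < phi c + s * d / 2.
  by rewrite ltrDl divr_gt0.
near=> t.
have h1 : `|y t - c| ^+ 2 <= phi c + s * d / 2 by near: t.
have h2 : d <= ip (y t - c) h by near: t.
have -> : `|y t - (c + s *: h)| ^+ 2 =
    `|y t - c| ^+ 2 - 2 * s * ip (y t - c) h + s * (s * `|h| ^+ 2).
  rewrite opprD addrA -!(ip_norm ipP) !(ipE ipP).
  by rewrite !(ipC ipP _ (y t)) !(ipC ipP h); ring.
rewrite hs; nra.
Unshelve. all: by end_near. Qed.

End AsymptoticCenter.

(** * Real functions on a ray *)

Section RealAnalysis.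
Context (R : realType).
Implicit Types f : R -> R.

Lemma is_derive_le0_nonincreasing f df (s t : R) : s <= t ->
  (forall x, s <= x <= t -> is_derive x 1 f (df x)) ->
  (forall x, s <= x <= t -> df x <= 0) -> f t <= f s.
Proof.
move=> st fd d0.
have dfs (x : R) : x \in `[s, t]%R -> derivable f x 1.
  by rewrite in_itv/= => /fd[].
apply: (@ler0_derive1_le_cc _ f s t) => //.
- by move=> x /subset_itv_oo_cc; exact: dfs.
- move=> x /subset_itv_oo_cc; rewrite in_itv/= => xst.
  by rewrite derive1E; have [_ ->] := fd _ xst; exact: d0.
- exact: derivable_within_continuous.
- by rewrite in_itv/= st lexx.
- by rewrite in_itv/= lexx st.
Qed.

(** A mean value inequality from the right Dini derivative alone, proved by continuous induction
    after subtracting an arbitrarily small slope [e]. *)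
Lemma dini_le0_nonincreasing f (s t : R) : s <= t ->
  (forall x, s <= x <= t -> {for x, continuous f}) ->
  (forall x, s <= x < t ->
     forall e, 0 < e -> \forall h \near 0^'+, f (x + h) - f x <= e * h) ->
  f t <= f s.
Proof.
move=> st fc fD.
have [->|s_neq_t] := eqVneq s t; first by [].
have ts0 : 0 < t - s by rewrite subr_gt0 lt_neqAle s_neq_t.
apply/ler_addgt0Pr => e0 e0_gt0.
pose e := e0 / (t - s).
have e_gt0 : 0 < e by rewrite divr_gt0.
have -> : e0 = e * (t - s) by rewrite /e -mulrA mulVf ?mulr1// gt_eqF.
pose g x := f x - e * x.
suff : g t <= g s by rewrite /g; lra.
(* Continuity puts [c = sup A] in [A]; if [c < t], the Dini estimate at [c] puts a later point in
   [A], a contradiction. *)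
pose A := [set x | s <= x <= t /\ g x <= g s].
have As : A s by split; rewrite ?lexx ?st.
have ubA : ubound A t by move=> x [/andP[]].
have supA : has_sup A by split; [exists s|exists t].
pose c := sup A.
have sc : s <= c := sup_upper_bound supA As.
have ct : c <= t by apply: ge_sup => //; exists s.
have gc : {for c, continuous g}.
  apply: cvgB; first by apply: fc; rewrite sc.
  by apply: cvgM; [exact: cvg_cst|exact: cvg_id].
have Ac : A c.
  split; first by rewrite sc ct.
  rewrite leNgt; apply/negP => gsc.
  have /cvgr_gt/(_ _ gsc)/nbhs_ballP[d /= d0 dP] := gc.
  have [x Ax cx] := sup_adherent d0 supA.
  have xc : x <= c := sup_upper_bound supA Ax.
  have : g s < g x.
    apply: dP; rewrite -ball_normE/= ger0_norm ?subr_ge0//.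
    by move: cx; rewrite -/c; lra.
  by case: Ax => _; rewrite leNgt => /negP.
have [->|c_neq_t] := eqVneq t c; first by case: Ac.
have ct' : c < t by rewrite lt_neqAle ct andbT eq_sym.
near (0 : R)^'+ => h.
have h0 : 0 < h by [].
have ht : h < t - c by near: h; apply: nbhs_right_lt; rewrite subr_gt0.
have fh : f (c + h) - f c <= e * h by near: h; apply: fD; rewrite ?sc.
suff Ach : A (c + h).
  by have := sup_upper_bound supA Ach; rewrite -/c; lra.
split; first by apply/andP; split; lra.
have [_] := Ac; rewrite /g; lra.
Unshelve. all: by end_near. Qed.

Lemma ray_nonincreasing_cvg (V : R -> R) (a : R) :
  (forall s t, a < s -> s <= t -> V t <= V s) -> (forall t, a < t -> 0 <= V t) ->
  cvg (V @ +oo).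
Proof.
move=> Vni V0; pose m := inf (V @` [set t | a < t]).
have Vinf : has_inf (V @` [set t | a < t]).
  split; first by exists (V (a + 1)), (a + 1) => //=; rewrite ltrDl.
  by exists 0 => _ [t /= at_ <-]; exact: V0.
apply/cvg_ex; exists m; apply/cvgrPdist_le => e e0.
have [_ [s /= as_ <-] Vs] := inf_adherent e0 Vinf.
near=> t.
have st : s <= t by near: t; apply: nbhs_pinfty_ge; rewrite num_real.
have mt : m <= V t.
  by apply: ge_inf; [exact: Vinf.2|exists t => //=; exact: lt_le_trans st].
have := Vni _ _ as_ st; move: Vs; rewrite -/m => h1 h2.
by rewrite distrC ger0_norm ?subr_ge0//; lra.
Unshelve. all: by end_near. Qed.

(* Along the part of the ray where [V] has almost reached its infimum, the
   increments of [A] times [b] are small; this passes to [A * b] because [A]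
   diverges. *)
Lemma mul_cvg0_of_increments (a : R) (V A b : R -> R) :
  (forall s t, a < s <= t -> (A t - A s) * b t <= V s - V t) ->
  (forall t, a < t -> 0 <= V t) -> (forall t, a < t -> 0 <= b t) ->
  A @ +oo --> +oo -> (fun t => A t * b t) @ +oo --> 0.
Proof.
move=> AbV V0 b0 Aoo.
pose m := inf (V @` [set t | a < t]).
have Vinf : has_inf (V @` [set t | a < t]).
  split; first by exists (V (a + 1)), (a + 1) => //=; rewrite ltrDl.
  by exists 0 => _ [t /= at_ <-]; exact: V0.
apply/cvgrPdist_le => e e0.
have e2 : 0 < e / 2 by rewrite divr_gt0.
have [_ [s /= as_ <-] Vs] := inf_adherent e2 Vinf.
near=> t.
have st : s <= t by near: t; apply: nbhs_pinfty_ge; rewrite num_real.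
have at_ : a < t by exact: lt_le_trans as_ st.
have mt : m <= V t by apply: ge_inf; [exact: Vinf.2|exists t].
(* This makes [|A s| <= A t - A s], so [A s * b t] is also at most [e / 2]. *)
have At : A s + `|A s| + 1 <= A t.
  by near: t; move/cvgryPge : Aoo; apply.
have bt := b0 _ at_.
have h1 : (A t - A s) * b t <= V s - V t by apply: AbV; rewrite as_.
have As := ler_norm (A s).
have As' := normr_ge0 (A s).
have As2 : - A s <= `|A s| by rewrite -normrN ler_norm.
rewrite sub0r normrN ger0_norm ?mulr_ge0//; last by lra.
have h2 : `|A s| * b t <= (A t - A s) * b t by apply: ler_wpM2r => //; lra.
have h3 : A s * b t <= `|A s| * b t by exact: ler_wpM2r.
move: Vs; rewrite -/m; nra.
Unshelve. all: by end_near. Qed.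

Local Notation mu := (@lebesgue_measure R).

Lemma continuous_ray_integrable f (a t : R) :
  {within `[a, +oo[, continuous f} -> mu.-integrable `[a, t] (EFin \o f).
Proof.
move=> fc; apply: continuous_compact_integrable; first exact: segment_compact.
by apply: continuous_subspaceW fc; exact: subset_itvl.
Qed.

Lemma is_derive_primitive f (a t : R) : a < t ->
  {within `[a, +oo[, continuous f} ->
  is_derive t 1 (fun x => \int[mu]_(r in `[a, x]) f r) (f t).
Proof.
move=> at_ fc.
have ft : {for t, continuous f}.
  have /continuous_within_itvcyP[+ _] := fc; apply.
  by rewrite in_itv/= at_.
have tt1 : t < t + 1 by rewrite ltrDl.
have [d e] :=
  continuous_FTC1_closed tt1 (continuous_ray_integrable (t + 1) fc) at_ ft.
by split; [exact: d|rewrite -derive1E; exact: e].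
Qed.

(** The primitive is monotone and bounded, hence convergent, and the fundamental theorem on the ray
    gives the integral a finite value. *)
Lemma integral_ray_lty f (a b K : R) : {within `[a, +oo[, continuous f} ->
  (forall x, a <= x -> 0 <= f x) ->
  (forall t, b <= t -> \int[mu]_(r in `[a, t]) f r <= K) ->
  (\int[mu]_(x in `[a, +oo[) (f x)%:E < +oo)%E.
Proof.
move=> fc f0 fK.
pose F x := \int[mu]_(r in `[a, x]) f r.
(* Vanishing to the left of [a] makes [F] monotone on the whole line. *)
have Fle0 x : x <= a -> F x = 0.
  rewrite le_eqVlt => /predU1P[->|xa].
    by rewrite /F set_itv1 Rintegral_set1.
  by rewrite /F set_itv_ge ?Rintegral_set0// bnd_simp -ltNge.
have F0 x : 0 <= F x.
  by apply: Rintegral_ge0 => r /=; rewrite in_itv/= => /andP[/f0].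
have Fnd : nondecreasing_fun F.
  move=> x z xz; have [/Fle0->//|ax] := leP x a.
  rewrite -lerN2.
  apply: (@is_derive_le0_nonincreasing (fun u => - F u) (fun u => - f u)) => //.
  - move=> u /andP[xu _]; apply: is_deriveN.
    by apply: is_derive_primitive => //; exact: lt_le_trans xu.
  - by move=> u /andP[xu _]; rewrite oppr_le0 f0// ltW// (lt_le_trans ax).
have Fub : has_ubound (range F).
  exists K => _ [x _ <-]; apply: (@le_trans _ _ (F (Num.max x b))).
    by apply: Fnd; rewrite le_max lexx.
  by apply: fK; rewrite le_max lexx orbT.
have Fcvg := nondecreasing_cvgr Fnd Fub.
rewrite (@ge0_continuous_FTC2y _ f F a _ f0 fc Fcvg).
- by rewrite -EFinD ltry.
- by move=> x ax; have [] := is_derive_primitive ax fc.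
- rewrite (Fle0 a)//; apply: cvg_at_right_filter.
  apply: (@parameterized_integral_cvg_left _ a (a + 1) f).
    by rewrite ltrDl.
  exact: continuous_ray_integrable.
- move=> x; rewrite in_itv/= andbT => ax.
  by rewrite derive1E; have [_ ->] := is_derive_primitive ax fc.
Qed.

End RealAnalysis.

(** * Gradients along curves *)

Section Calculus.
Context (R : realType).

Lemma is_derive1P (V : normedModType R) (y : R -> V) (t : R) (d : V) :
  is_derive t 1 y d <-> h^-1 *: (y (t + h) - y t) @[h --> 0^'] --> d.
Proof.
have -> : (fun h => h^-1 *: (y (t + h) - y t)) =
          (fun h => h^-1 *: ((y \o shift t) (h *: 1) - y t)).
  by apply/funext => h; congr (_ *: (y _ - _)); rewrite /= [_%:A]mulr1 addrC.
split => [[yt <-]|yd]; first exact: yt.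
by split; [apply/cvg_ex; exists d|apply: cvg_lim => //; exact: norm_hausdorff].
Qed.

Lemma is_derive_continuous (V : normedModType R) (y : R -> V) (t : R) (d : V) :
  is_derive t 1 y d -> {for t, continuous y}.
Proof.
by move=> [yt _]; apply: differentiable_continuous; exact/derivable1_diffP.
Qed.

Lemma is_derive_shift_cvg (V : normedModType R) (y : R -> V) (t : R) (d : V) :
  is_derive t 1 y d -> y (t + h) @[h --> 0^'] --> y t.
Proof.
move=> /is_derive_continuous yc; apply: cvg_within_filter.
have th : (t + h) @[h --> (0 : R)] --> t.
  by rewrite -[X in _ --> X]addr0; apply: cvgD; [exact: cvg_cst|exact: cvg_id].
exact: cvg_comp th yc.
Qed.

Lemma is_derive_sqdist (H : normedModType R) (ip : H -> H -> R) (y : R -> H)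
    (x d : H) (t : R) : is_inner_product ip -> is_derive t 1 y d ->
  is_derive t 1 (fun r => `|y r - x| ^+ 2) (2 * ip (y t - x) d).
Proof.
move=> ipP yd; apply/is_derive1P.
(* A difference of squares: the inner product of the sum with the difference quotient, whose two
   factors converge. *)
have -> : (fun h : R => h^-1 *: (`|y (t + h) - x| ^+ 2 - `|y t - x| ^+ 2)) =
    (fun h => ip (y (t + h) + (y t - (2 *: x)))(h^-1 *: (y (t + h) - y t))).
  apply/funext => h; rewrite -!(ip_norm ipP) !(ipE ipP) /GRing.scale/=.
  by rewrite !(ipC ipP x) (ipC ipP (y (t + h)) (y t)); ring.
have -> : 2 * ip (y t - x) d = ip (y t + (y t - 2 *: x)) d.
  by rewrite !(ipE ipP); ring.
apply: cvg_ip => //; last exact/is_derive1P.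
by apply: cvgD; [exact: is_derive_shift_cvg yd|exact: cvg_cst].
Qed.

Lemma is_derive_comp_grad (H : normedModType R) (ip : H -> H -> R)
    (f : H -> R) (gf : H -> H) (y : R -> H) (d : H) (t : R) :
  (forall x : H, differentiable f x /\ forall h : H, 'd f x h = ip (gf x) h) ->
  is_derive t 1 y d -> is_derive t 1 (fun r => f (y r)) (ip (gf (y t)) d).
Proof.
move=> fg [/derivable1_diffP yt yd]; have [ft fE] := fg (y t).
have fy : differentiable (f \o y) t by exact: differentiable_comp.
split; first exact: diff_derivable.
by rewrite [LHS](deriveE _ fy) diff_comp//= fE -deriveE// yd.
Qed.

End Calculus.

(** * First-order inequalities for convex functions *)

Section ConvexGradient.
Context (R : realType) (H : normedModType R) (ip : H -> H -> R).
Context (f : H -> R) (gf : H -> H).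
Hypothesis ipP : is_inner_product ip.
Hypothesis fconv : convex_fun f.
Hypothesis fgrad : forall x : H,
  differentiable f x /\ forall h : H, 'd f x h = ip (gf x) h.

(** By convexity the difference quotients from [x] towards [z] are at most [f z - f x] for steps in
    []0, 1]]; let the step tend to 0. *)
Lemma convex_gradient_le x z : f x + ip (gf x) (z - x) <= f z.
Proof.
have [fx fE] := fgrad x.
have dfx : h^-1 *: (f (h *: (z - x) + x) - f x) @[h --> 0^'] --> ip (gf x) (z - x).
  rewrite -fE -deriveE//.
  exact: (diff_derivable fx).
suff : ip (gf x) (z - x) <= f z - f x by lra.
apply: (ler_cvg_to (cvg_dnbhs_at_right dfx) (cvg_cst _)).
near=> h.
have h0 : 0 < h by [].
have h1 : h <= 1 by near: h; apply: nbhs_right_le.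
rewrite /GRing.scale/= mulrC ler_pdivrMr// [leRHS]mulrC.
have -> : h *: (z - x) + x = h *: z + (1 - h) *: x.
  by rewrite scalerBr scalerBl scale1r addrAC addrA.
have := @fconv z x h; rewrite (ltW h0) h1 => /(_ isT); lra.
Unshelve. all: by end_near. Qed.

Lemma convex_gradient_monotone x z : 0 <= ip (gf x - gf z) (x - z).
Proof.
have := convex_gradient_le x z; have := convex_gradient_le z x.
rewrite !(ipE ipP); lra.
Qed.

End ConvexGradient.

(** * Rescaled gradient flow *)

Section ScaledGradientFlow.
Context (R : realType) (H : completeNormedModType R) (ip : H -> H -> R).
Context (f : H -> R) (gf : H -> H) (a : R) (tau dtau : R -> R) (y : R -> H).
Hypothesis ipP : is_inner_product ip.
Hypothesis fA : assumption_A ip f gf.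
Hypothesis tau_gt0 : forall t, a < t -> 0 < tau t.
Hypothesis dtau_gt0 : forall t, a < t -> 0 < dtau t.
Hypothesis tauD : forall t, a < t -> is_derive t 1 tau (dtau t).
Hypothesis yD : forall t, a < t -> is_derive t 1 y (- dtau t *: gf (y t)).

Let fconv : convex_fun f. Proof. by case: fA. Qed.
Let fgrad : forall x : H,
  differentiable f x /\ forall h : H, 'd f x h = ip (gf x) h.
Proof. by case: fA. Qed.

Let valueD t : a < t ->
  is_derive t 1 (fun r => f (y r)) (- dtau t * `|gf (y t)| ^+ 2).
Proof.
move=> at_; have := is_derive_comp_grad fgrad (yD at_).
by rewrite (ipZr ipP) (ip_norm ipP).
Qed.

Let distD xs t : a < t -> is_derive t 1 (fun r => 2^-1 * `|y r - xs| ^+ 2)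
  (- dtau t * ip (gf (y t)) (y t - xs)).
Proof.
move=> at_; have := is_derive_sqdist xs ipP (yD at_) => d.
apply: is_derive_eq (is_deriveZ 2^-1 d) _.
by rewrite /GRing.scale/= (ipZr ipP) (ipC ipP (gf _)); field.
Qed.

Lemma flow_value_nonincreasing s t : a < s -> s <= t -> f (y t) <= f (y s).
Proof.
move=> as_ st; apply: (is_derive_le0_nonincreasing st (f := fun r => f (y r))).
  by move=> x /andP[sx _]; apply: valueD; exact: lt_le_trans sx.
move=> x /andP[sx _]; rewrite mulNr oppr_le0 mulr_ge0 ?sqr_ge0// ltW// dtau_gt0//.
exact: lt_le_trans sx.
Qed.

(** By convexity, half the squared distance decreases at rate at least [dtau] times the current
    value gap, which dominates the gap [k] frozen at the final time [t]. *)
Lemma flow_value_increment xs s t : argmin f xs -> a < s -> s <= t ->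
  (tau t - tau s) * (f (y t) - f xs) <=
  2^-1 * `|y s - xs| ^+ 2 - 2^-1 * `|y t - xs| ^+ 2.
Proof.
move=> xsP as_ st; set k := f (y t) - f xs.
pose g r := 2^-1 * `|y r - xs| ^+ 2 + k * tau r.
suff : g t <= g s by rewrite /g; lra.
have gD x : a < x ->
    is_derive x 1 g (- dtau x * ip (gf (y x)) (y x - xs) + k * dtau x).
  move=> ax; exact: is_deriveD (distD xs ax) (is_deriveZ k (tauD ax)).
apply: (is_derive_le0_nonincreasing st) => x /andP[sx xt].
  by apply: gD; exact: lt_le_trans sx.
have ax : a < x by exact: lt_le_trans sx.
have := convex_gradient_le fconv fgrad (y x) xs.
have := flow_value_nonincreasing ax xt.
have := dtau_gt0 ax.
rewrite -(opprB (y x)) (ipNr ipP) /k; nra.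
Qed.

Lemma flow_tau_nondecreasing s t : a < s -> s <= t -> tau s <= tau t.
Proof.
move=> as_ st; rewrite -lerN2.
apply: (is_derive_le0_nonincreasing st (f := fun r => - tau r)
  (df := fun r => - dtau r)).
  by move=> x /andP[sx _]; apply: is_deriveN; apply: tauD; exact: lt_le_trans sx.
by move=> x /andP[sx _]; rewrite oppr_le0 ltW// dtau_gt0//; exact: lt_le_trans sx.
Qed.

Lemma flow_dist_nonincreasing xs s t : argmin f xs -> a < s -> s <= t ->
  `|y t - xs| ^+ 2 <= `|y s - xs| ^+ 2.
Proof.
move=> xsP as_ st; have := flow_value_increment xsP as_ st.
have : 0 <= (tau t - tau s) * (f (y t) - f xs).
  by rewrite mulr_ge0// subr_ge0 ?flow_tau_nondecreasing//; exact: xsP.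
lra.
Qed.

(* The gradient is not assumed differentiable, so only a one-sided Dini
   estimate is available: monotonicity of the gradient bounds the inner product
   of its increment with [gf (y x)], and the squared increment is of second
   order by local Lipschitz continuity. *)
Lemma flow_grad_nonincreasing s t : a < s -> s <= t ->
  `|gf (y t)| ^+ 2 <= `|gf (y s)| ^+ 2.
Proof.
move=> as_ st; have [_ _ gfc _ gfL] := fA.
have cN x : a < x -> {for x, continuous (fun r => `|gf (y r)| ^+ 2)}.
  move=> ax; have yc := is_derive_continuous (yD ax).
  have gyc : {for x, continuous (fun r => gf (y r))}.
    by apply: continuous_comp; [exact: yc|exact: gfc].
  have nc : (fun r => `|gf (y r)|) @ x --> `|gf (y x)| by exact: cvg_norm.
  exact: (cvgM nc nc).
apply: (dini_le0_nonincreasing st (f := fun r => `|gf (y r)| ^+ 2)).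
  by move=> x /andP[sx _]; apply: cN; exact: lt_le_trans sx.
move=> x /andP[sx _] e e0; have ax : a < x by exact: lt_le_trans sx.
(* The unit ball around [y x] suffices, since [y] stays in it for small [h]. *)
have [|L0 L0P] := gfL [set z | `|z - y x| <= 1].
  exists (1 + `|y x|) => z /= zy; rewrite -[z](subrK (y x)).
  by rewrite (le_trans (ler_normD _ _))// lerD2r.
pose L := `|L0|.
have LP z : `|z - y x| <= 1 -> `|gf z - gf (y x)| <= L * `|z - y x|.
  move=> zy; apply: (@le_trans _ _ (L0 * `|z - y x|)).
    by apply: L0P => //=; rewrite subrr normr0.
  by rewrite ler_wpM2r// ler_norm.
set D := - dtau x *: gf (y x).
have /is_derive1P qD := yD ax; rewrite -/D in qD.
pose q h := h^-1 *: (y (x + h) - y x).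
have {qD} qD : q h @[h --> 0^'+] --> D by exact: cvg_dnbhs_at_right.
have yx : y (x + h) @[h --> 0^'+] --> y x.
  exact: cvg_dnbhs_at_right (is_derive_shift_cvg (yD ax)).
have nq : `|q h| @[h --> 0^'+] --> `|D| by exact: cvg_norm.
have nqD : `|q h - D| @[h --> 0^'+] --> (0 : R).
  rewrite -[X in _ --> X](normr0 H) -(subrr D); apply: cvg_norm.
  by apply: cvgB => //; exact: cvg_cst.
(* [B h * h] will bound the increment of [|gf (y x)|^2]: the first term comes from the cross term,
   the second from the squared increment. It vanishes because [q h] tends to [D]. *)
pose B h := 2 * L / dtau x * (`|q h| * `|q h - D|) + h * (L ^+ 2 * (`|q h| * `|q h|)).
have B0 : B h @[h --> 0^'+] --> (0 : R).
  suff : B h @[h --> 0^'+] -->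
      2 * L / dtau x * (`|D| * 0) + 0 * (L ^+ 2 * (`|D| * `|D|)).
    by rewrite !(mulr0, mul0r) addr0.
  apply: cvgD.
    by apply: cvgM; [exact: cvg_cst|exact: (cvgM nq nqD)].
  apply: cvgM; first by apply: cvg_at_right_filter; exact: cvg_id.
  by apply: cvgM; [exact: cvg_cst|exact: (cvgM nq nq)].
near=> h.
have h0 : 0 < h by [].
have Be : B h <= e by near: h; have /cvgr_le := B0; apply.
apply: (@le_trans _ _ (B h * h)); last by rewrite ler_pM2r.
have yh : `|y (x + h) - y x| <= 1.
  rewrite distrC; near: h.
  by have /cvgrPdist_le := yx; apply.
have hq : y (x + h) - y x = h *: q h.
  by rewrite /q scalerA divff ?scale1r// gt_eqF.
set G := gf (y x); set dG := gf (y (x + h)) - G.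
have dGL : `|dG| <= L * (h * `|q h|).
  by have := LP _ yh; rewrite hq normrZ (gtr0_norm h0).
have dt0 := dtau_gt0 ax.
have L_ge0 : 0 <= L by exact: normr_ge0.
have mono : 0 <= ip dG (q h).
  have := convex_gradient_monotone ipP fconv fgrad (y (x + h)) (y x).
  by rewrite hq (ipZr ipP) pmulr_rge0.
(* As [D = - dtau x *: G], the left side is [ip dG (q h - D) - ip dG (q h)], and monotonicity lets
   the last term be dropped. *)
have ipG : dtau x * ip dG G <= `|dG| * `|q h - D|.
  have := cauchy_schwarz ipP dG (q h - D).
  have -> : ip dG (q h - D) = ip dG (q h) + dtau x * ip dG G.
    by rewrite (ipBr ipP) /D (ipZr ipP (- dtau x)) mulNr opprK.
  by apply: le_trans; rewrite lerDr.
have -> : gf (y (x + h)) = G + dG by rewrite /dG subrKC.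
have -> : `|G + dG| ^+ 2 - `|G| ^+ 2 = 2 * ip dG G + `|dG| ^+ 2.
  by rewrite -!(ip_norm ipP) !(ipE ipP) (ipC ipP G); ring.
have ipG' : ip dG G <= L * (h * `|q h|) * `|q h - D| / dtau x.
  rewrite ler_pdivlMr// mulrC (le_trans ipG)//.
  by rewrite ler_wpM2r.
have dG2 : `|dG| ^+ 2 <= (L * (h * `|q h|)) ^+ 2.
  by rewrite ler_sqr ?nnegrE// !mulr_ge0// ltW.
rewrite [leRHS](_ : _ = 2 * (L * (h * `|q h|) * `|q h - D| / dtau x) +
  (L * (h * `|q h|)) ^+ 2); last by rewrite /B; field; rewrite gt_eqF.
by apply: lerD => //; rewrite ler_pM2l.
Unshelve. all: by end_near. Qed.

Definition flow_energy xs t : R :=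
  tau t * (f (y t) - f xs) + 2^-1 * `|y t - xs| ^+ 2.

Lemma flow_energy_ge0 xs t : argmin f xs -> a < t -> 0 <= flow_energy xs t.
Proof.
move=> xsP at_; rewrite /flow_energy addr_ge0//.
by rewrite mulr_ge0 ?subr_ge0 ?(ltW (tau_gt0 _))//; exact: xsP.
Qed.

(** The product rule produces [dtau] times the value gap, which convexity absorbs into the
    derivative of the distance term. *)
Lemma flow_energy_derive xs t : argmin f xs -> a < t ->
  exists2 d, is_derive t 1 (flow_energy xs) d &
             d <= - (tau t * dtau t * `|gf (y t)| ^+ 2).
Proof.
move=> xsP at_.
have d1 := is_deriveB (valueD at_) (is_derive_cst (f xs) t (1 : R)).
have d2 := is_deriveD (is_deriveM (tauD at_) d1) (distD xs at_).
eexists; first exact: d2.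
have := convex_gradient_le fconv fgrad (y t) xs.
have := dtau_gt0 at_.
rewrite -(opprB (y t)) (ipNr ipP) /GRing.scale/= subr0 !fctE; nra.
Qed.

(** The gradient norm is frozen at its final value, its smallest on [[s, t]], and [tau * dtau] is
    the derivative of [tau^2 / 2]. *)
Lemma flow_energy_increment xs s t : argmin f xs -> a < s -> s <= t ->
  (2^-1 * tau t ^+ 2 - 2^-1 * tau s ^+ 2) * `|gf (y t)| ^+ 2 <=
  flow_energy xs s - flow_energy xs t.
Proof.
move=> xsP as_ st; set k := `|gf (y t)| ^+ 2.
pose g r := flow_energy xs r + (k / 2) * (tau r * tau r).
suff : g t <= g s by rewrite /g; lra.
(* The derivative is known only existentially; choice makes it a function, with the value 0 off the
   ray. *)
have /choice[dE dEP] : forall x, exists d, a < x ->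
    is_derive x 1 (flow_energy xs) d /\ d <= - (tau x * dtau x * `|gf (y x)| ^+ 2).
  move=> x; have [ax|_] := ltP a x; last by exists 0.
  by have [d ? ?] := flow_energy_derive xsP ax; exists d.
have gD x : a < x -> is_derive x 1 g (dE x + k * (tau x * dtau x)).
  move=> ax; have [dEx _] := dEP x ax.
  apply: is_derive_eq
    (is_deriveD dEx (is_deriveZ (k / 2) (is_deriveM (tauD ax) (tauD ax)))) _.
  by rewrite /GRing.scale/=; field.
apply: (is_derive_le0_nonincreasing st) => x /andP[sx xt].
  by apply: gD; exact: lt_le_trans sx.
have ax : a < x by exact: lt_le_trans sx.
have [_ dEx] := dEP x ax.
have : k * (tau x * dtau x) <= `|gf (y x)| ^+ 2 * (tau x * dtau x).
  rewrite ler_wpM2r ?mulr_ge0 ?(ltW (tau_gt0 ax)) ?(ltW (dtau_gt0 ax))//.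
  exact: flow_grad_nonincreasing.
lra.
Qed.

Lemma flow_grad_bounded s : a < s ->
  exists2 K, 0 < K & forall t, s <= t -> tau t * `|gf (y t)| <= K.
Proof.
move=> as_; have [_ _ _ [xs xsP] _] := fA.
pose C := 2 * flow_energy xs s + tau s ^+ 2 * `|gf (y s)| ^+ 2.
have C0 : 0 <= C.
  by rewrite addr_ge0// mulr_ge0 ?sqr_ge0// flow_energy_ge0.
(* [C] bounds the square of [tau t * |gf (y t)|]; the inequality [C <= (C + 1)^2] avoids a square
   root and keeps the bound positive. *)
exists (C + 1); first by rewrite ltr_wpDl.
move=> t st; have at_ : a < t by exact: lt_le_trans st.
have h1 := flow_energy_increment xsP as_ st.
have h2 := flow_energy_ge0 xsP at_.
have h3 : tau s ^+ 2 * `|gf (y t)| ^+ 2 <= tau s ^+ 2 * `|gf (y s)| ^+ 2.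
  by rewrite ler_wpM2l ?sqr_ge0// flow_grad_nonincreasing.
have h4 : 0 <= tau t * `|gf (y t)| by rewrite mulr_ge0// ltW// tau_gt0.
have C1 : 0 <= C + 1 by rewrite addr_ge0.
rewrite -ler_sqr// exprMn; apply: (@le_trans _ _ C); last by nra.
by rewrite /C; lra.
Qed.

End ScaledGradientFlow.

(** * Opial's lemma and limits of the flow *)

Section WeakConvergence.
Context (R : realType) (H : completeNormedModType R) (ip : H -> H -> R).
Context (f : H -> R) (gf : H -> H) (y : R -> H).
Hypothesis ipP : is_inner_product ip.
Hypothesis fconv : convex_fun f.
Hypothesis fgrad : forall x : H,
  differentiable f x /\ forall h : H, 'd f x h = ip (gf x) h.

(** If [f c > f xs], convexity at [c] keeps [ip (y t - c) (- gf c)] eventually above half the gap,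
    which a center forbids. *)
Lemma minimizing_asymptotic_center_argmin (F : set_system R)
    (FF : ProperFilter F) xs c : argmin f xs ->
  (exists M, \forall t \near F, `|y t| <= M) -> (fun t => f (y t)) @ F --> f xs ->
  (forall x, asymptotic_sqradius F y c <= asymptotic_sqradius F y x) ->
  argmin f c.
Proof.
move=> xsP ybnd fy cmin; suff fc : f c <= f xs.
  by move=> z; apply: le_trans fc _; exact: xsP.
rewrite leNgt; apply/negP => fxc.
have d0 : 0 < (f c - f xs) / 2 by rewrite divr_gt0// subr_gt0.
apply: (asymptotic_center_ip ipP FF ybnd (h := - gf c) cmin d0).
have fxd : f xs < f xs + (f c - f xs) / 2 by rewrite ltrDl.
have /cvgr_le/(_ _ fxd) := fy; apply: filterS => t fyt.
have := convex_gradient_le fconv fgrad c (y t).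
rewrite (ipNr ipP) (ipC ipP (y t - c)); lra.
Qed.

(* Opial's argument without weak compactness: a direction in which [y] stays
   away from its asymptotic center along an unbounded set of times is excluded
   by comparing with the asymptotic center along that set, since both centers
   are minimizers and distances to minimizers converge. *)
Lemma minimizing_fejer_weak_cvg xs : argmin f xs ->
  (forall c, argmin f c -> cvg ((fun t => `|y t - c| ^+ 2) @ +oo)) ->
  (fun t => f (y t)) @ +oo --> f xs ->
  exists2 c, argmin f c & weak_cvg_pinfty ip y c.
Proof.
move=> xsP ycvg fy.
have ybnd : exists M, \forall t \near +oo, `|y t| <= M.
  set l := lim ((fun t => `|y t - xs| ^+ 2) @ +oo).
  exists (l + 2 + `|xs|).
  have ll : l < l + 1 by rewrite ltrDl.
  have /cvgr_le/(_ _ ll) := ycvg _ xsP; apply: filterS => t h.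
  have h2 : `|y t| <= `|y t - xs| + `|xs|.
    by rewrite -{1}[y t](subrK xs) ler_normD.
  have := sqr_ge0 (`|y t - xs| - 1); nra.
have [c cmin] := asymptotic_center ipP _ ybnd.
have cP : argmin f c by exact: minimizing_asymptotic_center_argmin xsP ybnd fy cmin.
exists c => //.
(* A one-sided bound for every direction suffices, since [h] can be replaced by [- h]. *)
have below h d : 0 < d -> \forall t \near +oo, ip (y t - c) h < d.
  move=> d0; apply: contrapT => ndy.
  pose A := [set t | d <= ip (y t - c) h].
  (* This filter is proper exactly because the negated claim makes [A] unbounded to the right. *)
  pose F := within A +oo%R.
  have Foo (P : set R) : (\forall t \near +oo, P t) -> F P.
    by move=> Pt; rewrite /F /within /=; apply: filterS Pt.
  have FF : ProperFilter F.
    apply: Build_ProperFilter => F0; apply: ndy.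
    have {}F0 : \forall t \near +oo, A t -> False by exact: F0.
    by apply: filterS F0 => t At; rewrite ltNge; apply/negP => /At.
  have ybndF : exists M, \forall t \near F, `|y t| <= M.
    by have [M My] := ybnd; exists M; exact: Foo.
  have fyF : (fun t => f (y t)) @ F --> f xs by move=> P /fy; exact: Foo.
  have sqE x : argmin f x -> asymptotic_sqradius F y x = asymptotic_sqradius +oo%R y x.
    move=> xP; rewrite (asymptotic_sqradius_cvg _ ybnd (ycvg _ xP)).
    apply: asymptotic_sqradius_cvg => // P /(ycvg _ xP); exact: Foo.
  have [c' cmin'] := asymptotic_center ipP FF ybndF.
  have cP' : argmin f c'.
    exact: minimizing_asymptotic_center_argmin xsP ybndF fyF cmin'.
  (* Chain: the radius of [c] along [F] equals that along [+oo], which is at most that of [c'],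
     itself minimal along [F]. *)
  have cminF x : asymptotic_sqradius F y c <= asymptotic_sqradius F y x.
    by apply: le_trans (cmin' x); rewrite !sqE.
  apply: (asymptotic_center_ip ipP FF ybndF (h := h) cminF d0).
  by suff : \forall t \near +oo, A t -> A t by []; exact: nearW.
move=> h; apply/cvgrPdist_lt => e e0.
near=> t; rewrite distrC -(ipBl ipP) ltr_norml; apply/andP; split.
  by rewrite ltrNl -(ipNr ipP); near: t; exact: below.
by near: t; exact: below.
Unshelve. all: by end_near. Qed.

End WeakConvergence.

(** * Asymptotics of the rescaled flow when [tau] diverges *)

Section ScaledGradientFlowLimit.
Context (R : realType) (H : completeNormedModType R) (ip : H -> H -> R).
Context (f : H -> R) (gf : H -> H) (a : R) (tau dtau : R -> R) (y : R -> H).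
Hypothesis ipP : is_inner_product ip.
Hypothesis fA : assumption_A ip f gf.
Hypothesis tau_gt0 : forall t, a < t -> 0 < tau t.
Hypothesis dtau_gt0 : forall t, a < t -> 0 < dtau t.
Hypothesis tauD : forall t, a < t -> is_derive t 1 tau (dtau t).
Hypothesis yD : forall t, a < t -> is_derive t 1 y (- dtau t *: gf (y t)).
Hypothesis tau_oo : tau @ +oo --> +oo.

Lemma flow_value_cvg xs : argmin f xs ->
  (fun t => tau t * (f (y t) - f xs)) @ +oo --> 0.
Proof.
move=> xsP.
apply: (@mul_cvg0_of_increments _ a (fun t => 2^-1 * `|y t - xs| ^+ 2)) => //.
- by move=> s t /andP[as_ st]; exact: (flow_value_increment ipP fA dtau_gt0 tauD yD).
- by move=> t _; rewrite subr_ge0; exact: xsP.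
Qed.

(** The increment comparison is applied with [tau^2 / 2] against the energy, then a square root is
    taken. *)
Lemma flow_grad_cvg : (fun t => tau t * `|gf (y t)|) @ +oo --> 0.
Proof.
have [_ _ _ [xs xsP] _] := fA.
have tau2_oo : (fun t => 2^-1 * tau t ^+ 2) @ +oo --> +oo.
  apply/cvgryPge => M; have /cvgryPge/(_ (`|M| + 2)) := tau_oo.
  apply: filterS => t tM; have := ler_norm M; have := normr_ge0 M; nra.
have sq0 : (fun t => 2^-1 * tau t ^+ 2 * `|gf (y t)| ^+ 2) @ +oo --> 0.
  apply: (@mul_cvg0_of_increments _ a (flow_energy f tau y xs)) => //.
  - move=> s t /andP[as_ st].
    exact: (flow_energy_increment ipP fA tau_gt0 dtau_gt0 tauD yD).
  - by move=> t; exact: flow_energy_ge0.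
apply/cvgrPdist_le => e e0.
have e2 : 0 < e ^+ 2 / 2 by rewrite divr_gt0// exprn_gt0.
have /cvgrPdist_le/(_ _ e2) h1 := sq0.
near=> t; have at_ : a < t by near: t; apply: nbhs_pinfty_gt; rewrite num_real.
have : `|0 - 2^-1 * tau t ^+ 2 * `|gf (y t)| ^+ 2| <= e ^+ 2 / 2 by near: t.
have t0 := tau_gt0 at_.
rewrite !sub0r !normrN !ger0_norm ?mulr_ge0 ?sqr_ge0 ?(ltW t0)// => h2.
rewrite -ler_sqr ?nnegrE ?mulr_ge0 ?(ltW t0) ?(ltW e0)// exprMn; lra.
Unshelve. all: by end_near. Qed.

Lemma flow_weak_cvg : exists2 xs, argmin f xs & weak_cvg_pinfty ip y xs.
Proof.
have [fconv fgrad _ [xs xsP] _] := fA.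
apply: (minimizing_fejer_weak_cvg ipP fconv fgrad xsP).
- move=> c cP; apply: (@ray_nonincreasing_cvg _ _ a); last by move=> t _; exact: sqr_ge0.
  by move=> s t; exact: (flow_dist_nonincreasing ipP fA dtau_gt0 tauD yD).
- apply/cvgrPdist_le => e e0.
  have /cvgrPdist_le/(_ _ e0) h1 := flow_value_cvg xsP.
  have /cvgryPge/(_ 1) h2 := tau_oo.
  near=> t.
  have : `|0 - tau t * (f (y t) - f xs)| <= e by near: t.
  have : 1 <= tau t by near: t.
  have fx : 0 <= f (y t) - f xs by rewrite subr_ge0; exact: xsP.
  move=> t1; rewrite sub0r normrN (distrC (f xs)) !ger0_norm ?mulr_ge0//; last by lra.
  nra.
Unshelve. all: by end_near. Qed.

End ScaledGradientFlowLimit.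

(** * The closed-loop system *)

Section ClosedLoop.
Context (R : realType) (H : completeNormedModType R) (ip : H -> H -> R).
Context (f : H -> R) (gf : H -> H) (t0 q p : R) (y dy : R -> H) (lam : R -> R).
Hypothesis ipP : is_inner_product ip.
Hypothesis fA : assumption_A ip f gf.
Hypotheses (t0_gt0 : 0 < t0) (q_ge : 1 / 2 <= q) (p_ge1 : 1 <= p).
Hypothesis yD : forall t, t0 < t -> is_derive t 1 y (dy t).
Hypothesis yc : {within `[t0, +oo[, continuous y}.
Hypothesis lam_gt0 : forall t, t0 <= t -> 0 < lam t.
Hypothesis lamc : {within `[t0, +oo[, continuous lam}.
Hypothesis flow : forall t, t0 < t ->
  dy t + derive1 (tau t0 q lam) t *: gf (y t) = 0.
Hypothesis loop : forall t, t0 <= t ->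
  lam t `^ p * `|gf (y t)| `^ (p - 1) = 1.

Local Notation mu := (@lebesgue_measure R).
Local Notation T := (tau t0 q lam).
Local Notation g t := (`|gf (y t)|).

Let u t := t0 + \int[mu]_(r in `[t0, t]) (lam r `^ q^-1).
(** The exponent that remains on the gradient norm when the feedback law is raised to the power
    [1 / (p q)]. *)
Let alpha := (p - 1) / (p * q).
Let cq := (q `^ q)^-1.
Let dT t := cq * (q * u t `^ (q - 1) * lam t `^ q^-1).

Let q_gt0 : 0 < q. Proof. by apply: lt_le_trans q_ge; rewrite divr_gt0. Qed.
Let p_gt0 : 0 < p. Proof. exact: lt_le_trans p_ge1. Qed.
Let cq_gt0 : 0 < cq. Proof. by rewrite invr_gt0 powR_gt0. Qed.
Let alpha_ge0 : 0 <= alpha.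
Proof. by rewrite divr_ge0 ?subr_ge0 ?mulr_ge0 ?(ltW p_gt0) ?(ltW q_gt0). Qed.

Lemma closed_loop_lamX_continuous r :
  {within `[t0, +oo[, continuous (fun t => lam t `^ r)}.
Proof.
apply: (@within_continuous_comp _ _ _ _ lam (fun x : R => x `^ r)) lamc.
move=> x; rewrite inE => -[t /=]; rewrite in_itv/= andbT => t0t <-.
exact: is_derive_continuous (is_derive1_powR r (lam_gt0 t0t)).
Qed.

Let u_gt0 t : 0 < u t.
Proof.
by rewrite ltr_pwDl// Rintegral_ge0// => r _; exact: powR_ge0.
Qed.

Let uD t : t0 < t -> is_derive t 1 u (lam t `^ q^-1).
Proof.
move=> t0t.
have := is_deriveD (is_derive_cst t0 t (1 : R))
  (is_derive_primitive t0t (@closed_loop_lamX_continuous q^-1)).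
by rewrite add0r.
Qed.

Let uXD r t : t0 < t ->
  is_derive t 1 (fun x => u x `^ r) (r * u t `^ (r - 1) * lam t `^ q^-1).
Proof.
by move=> t0t; exact: is_derive1_comp (is_derive1_powR r (u_gt0 t)) (uD t0t).
Qed.

Let TE t : T t = cq * u t `^ q. Proof. by []. Qed.

Let T_gt0 t : t0 < t -> 0 < T t.
Proof. by move=> _; rewrite TE mulr_gt0// powR_gt0. Qed.

Let dT_gt0 t : t0 < t -> 0 < dT t.
Proof.
by move=> t0t; rewrite !mulr_gt0// powR_gt0//; apply: lam_gt0; exact: ltW.
Qed.

Let TD t : t0 < t -> is_derive t 1 T (dT t).
Proof. by move=> t0t; exact (is_deriveZ cq (uXD q t0t)). Qed.

Let yD' t : t0 < t -> is_derive t 1 y (- dT t *: gf (y t)).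
Proof.
move=> t0t; apply: is_derive_eq (yD t0t) _.
have /eqP := flow t0t; rewrite derive1E; have [_ ->] := TD t0t.
by rewrite addr_eq0 scaleNr => /eqP.
Qed.

Lemma closed_loop_gradX t : t0 <= t -> g t `^ alpha = lam t `^ (- q^-1).
Proof.
move=> t0t; have lp := lam_gt0 t0t.
have /(congr1 (fun x => x `^ (p * q)^-1)) := loop t0t.
rewrite powRM ?powR_ge0// -!powRrM powR1 -/alpha.
have -> : p * (p * q)^-1 = q^-1 by field; rewrite !gt_eqF.
by move=> h; rewrite powRN -[LHS]mul1r -(mulVf (x := lam t `^ q^-1)) ?gt_eqF
  ?powR_gt0// -mulrA h mulr1.
Qed.

(** The flow estimates hold on the open ray beyond [t0]; [t1] is a starting time inside it. *)
Let t1 := t0 + 1.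
Let t01 : t0 < t1. Proof. by rewrite ltrDl. Qed.

(** This is [u t >= (c t)^p] raised to the power [r]: [r = q] serves the growth of [tau],
    [r = 2 q - 1] the integral. *)
Lemma closed_loop_growth : exists2 c, 0 < c &
  forall r t, 0 <= r -> t1 <= t -> c `^ (p * r) * t `^ (p * r) <= u t `^ r.
Proof.
have [K K0 KP] := flow_grad_bounded ipP fA T_gt0 dT_gt0 TD yD' t01.
pose C := K `^ alpha / cq `^ alpha.
have C0 : 0 < C by rewrite divr_gt0// powR_gt0.
(* Raising [T t * |gf (y t)| <= K] to the power [alpha] and eliminating the gradient gives a
   differential inequality, as [lam^(1/q)] is the derivative of [u]. *)
have uC t : t1 <= t -> u t `^ (1 - p^-1) <= C * lam t `^ q^-1.
  move=> t1t; have t0t : t0 <= t by rewrite (le_trans _ t1t)// ltW.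
  have Tp : 0 <= T t by rewrite ltW// T_gt0// (lt_le_trans t01).
  have := @ge0_ler_powR _ _ alpha_ge0 (T t * g t) K.
  rewrite !nnegrE mulr_ge0// (ltW K0) => /(_ isT isT (KP _ t1t)).
  rewrite powRM// TE powRM ?powR_ge0 ?(ltW cq_gt0)// -powRrM closed_loop_gradX//.
  have -> : q * alpha = 1 - p^-1 by rewrite /alpha; field; rewrite !gt_eqF.
  rewrite powRN ler_pdivrMr ?powR_gt0 ?lam_gt0// => h.
  by rewrite /C mulrAC ler_pdivlMr ?powR_gt0// mulrC.
pose v t := u t `^ p^-1.
(* The first entry is a lower bound for the derivative of [v]; the second gives [c * t1 <= v t1]. *)
pose c := Num.min (p^-1 / C) (v t1 / t1).
have t1_gt0 : 0 < t1 by rewrite addr_gt0.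
have c0 : 0 < c by rewrite lt_min !divr_gt0 ?invr_gt0// powR_gt0.
have vc t : t1 <= t -> c * t <= v t.
  move=> t1t.
  have vc1 : c * t1 - v t1 <= 0.
    by rewrite subr_le0 -ler_pdivlMr// ge_min lexx orbT.
  rewrite -subr_le0; apply: le_trans vc1.
  have gt_ x : t1 <= x -> t0 < x by exact: lt_le_trans.
  apply: (is_derive_le0_nonincreasing t1t (f := fun x => c * x - v x)
    (df := fun x => c - p^-1 * u x `^ (p^-1 - 1) * lam x `^ q^-1)).
    move=> x /andP[t1x _].
    apply: is_derive_eq
      (is_deriveB (is_deriveZ c (is_derive_id x (1 : R))) (uXD p^-1 (gt_ _ t1x))) _.
    by rewrite /GRing.scale/= mulr1.
  move=> x /andP[t1x _]; rewrite subr_le0.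
  apply: (@le_trans _ _ (p^-1 / C)); first by rewrite ge_min lexx.
  rewrite -mulrA ler_pM2l ?invr_gt0// -[p^-1 - 1]opprB powRN.
  rewrite -[leLHS]mul1r ler_pdivrMr// -mulrA mulrC ler_pdivlMr ?powR_gt0//.
  by rewrite mul1r mulrC uC.
exists c => // r t r0 t1t.
have t_ge0 : 0 <= t by rewrite (le_trans _ t1t)// ltW.
rewrite -powRM ?(ltW c0)//.
have -> : u t `^ r = v t `^ (p * r).
  by rewrite /v -powRrM mulrA mulVf ?mul1r// gt_eqF.
apply: ge0_ler_powR (vc _ t1t); rewrite ?nnegrE ?mulr_ge0 ?(ltW c0) ?(ltW p_gt0)//.
exact: powR_ge0.
Qed.

Lemma closed_loop_tau_ge : exists2 C, 0 < C &
  \forall t \near +oo, t `^ (p * q) <= C * T t.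
Proof.
have [c c0 cP] := closed_loop_growth.
exists (c `^ (p * q) * cq)^-1; first by rewrite invr_gt0 mulr_gt0// powR_gt0.
near=> t.
have t1t : t1 <= t by near: t; apply: nbhs_pinfty_ge; rewrite num_real.
rewrite [leRHS]mulrC ler_pdivlMr ?mulr_gt0 ?powR_gt0// TE [cq * _]mulrC mulrA.
by rewrite ler_pM2r// [leLHS]mulrC cP// ltW.
Unshelve. all: by end_near. Qed.

Lemma closed_loop_tau_pinfty : T @ +oo --> +oo.
Proof.
have [C C0 TC] := closed_loop_tau_ge.
have pq0 : 0 < p * q by rewrite mulr_gt0.
apply/cvgryPge => M; near=> t.
suff : C * M <= C * T t by rewrite ler_pM2l.
have : t `^ (p * q) <= C * T t by near: t.
apply: le_trans; apply: (@le_trans _ _ `|C * M|); first exact: ler_norm.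
have -> : `|C * M| = (`|C * M| `^ (p * q)^-1) `^ (p * q).
  by rewrite -powRrM mulVf ?powRr1// gt_eqF.
by apply: ge0_ler_powR; rewrite ?nnegrE ?powR_ge0 ?(ltW pq0).
Unshelve. all: by end_near. Qed.

Let cvg0_tau (b : R -> R) : (forall t, 0 <= b t) ->
  (fun t => T t * b t) @ +oo --> 0 -> (fun t => b t * t `^ (p * q)) @ +oo --> 0.
Proof.
move=> b0 Tb; have [C C0 TC] := closed_loop_tau_ge.
apply: (@squeeze_cvgr _ _ _ _ (cst 0) (fun t => C * (T t * b t))).
- near=> t; rewrite mulr_ge0 ?powR_ge0//= mulrA mulrC ler_wpM2r//.
  by near: t.
- exact: cvg_cst.
- by rewrite -[X in _ --> X](mulr0 C); apply: cvgM => //; exact: cvg_cst.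
Unshelve. all: by end_near. Qed.

Lemma closed_loop_value :
  (fun t => (f (y t) - inf (range f)) * t `^ (p * q)) @ +oo --> 0.
Proof.
have [_ _ _ [xs xsP] _] := fA.
have -> : inf (range f) = f xs.
  apply/eqP; rewrite eq_le; apply/andP; split.
    by apply: ge_inf; [exists (f xs) => _ [z _ <-]|exists xs].
  by apply: lb_le_inf; [exists (f xs), xs|move=> _ [z _ <-]].
apply: cvg0_tau; first by move=> t; rewrite subr_ge0.
exact: (flow_value_cvg ipP fA dT_gt0 TD yD' closed_loop_tau_pinfty xsP).
Qed.

Lemma closed_loop_grad : (fun t => g t * t `^ (p * q)) @ +oo --> 0.
Proof.
apply: cvg0_tau; first by move=> t; exact: normr_ge0.
exact: (flow_grad_cvg ipP fA T_gt0 dT_gt0 TD yD' closed_loop_tau_pinfty).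
Qed.

(** Beyond [t1] the integrand is at most a constant times [T dT |gf (y t)|^2], which the decrease of
    the energy controls. *)
Lemma closed_loop_integral :
  (\int[mu]_(t in `[t0, +oo[)
     (t `^ (p * q * (2 - q^-1)) * g t `^ (2 + (p - 1) / (p * q)))%:E < +oo)%E.
Proof.
pose e := p * q * (2 - q^-1).
have eE : e = p * (2 * q - 1) by rewrite /e; field; rewrite gt_eqF.
(* The feedback law trades the fractional power of the gradient norm for a power of [lam > 0], so
   continuity is clear even where the gradient vanishes. *)
pose psi t := t `^ e * (g t * g t * lam t `^ (- q^-1)).
have t_gt0 t : t0 <= t -> 0 < t by exact: lt_le_trans.
have psi_ge0 t : t0 <= t -> 0 <= psi t.
  by move=> t0t; rewrite !mulr_ge0 ?powR_ge0.
have psic : {within `[t0, +oo[, continuous psi}.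
  have idc : {within `[t0, +oo[, continuous (fun t : R => t `^ e)}.
    apply: continuous_in_subspaceT => x; rewrite inE/= in_itv/= andbT => t0x.
    exact: is_derive_continuous (is_derive1_powR e (t_gt0 _ t0x)).
  have gc : {within `[t0, +oo[, continuous (fun t => g t)}.
    have [_ _ gfc _ _] := fA.
    have gyc : {within `[t0, +oo[, continuous (gf \o y)}.
      by apply: within_continuous_comp yc => z _; exact: gfc.
    by move=> x; apply: cvg_norm; exact: gyc.
  have lc := @closed_loop_lamX_continuous (- q^-1).
  move=> x; apply: cvgM; first exact: idc.
  by apply: cvgM; [apply: cvgM; exact: gc|exact: lc].
rewrite [ltLHS](_ : _ = \int[mu]_(t in `[t0, +oo[) (psi t)%:E)%E; last first.
  apply: eq_integral => t; rewrite inE/= in_itv/= andbT => t0t; congr (_%:E).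
  rewrite /psi -/e; congr (_ * _).
  rewrite powRD; last by rewrite gt_eqF// ltr_wpDr.
  by rewrite closed_loop_gradX// powR_mulrn// expr2.
have [c c0 cP] := closed_loop_growth.
have [_ _ _ [xs xsP] _] := fA.
pose B := g t1 `^ alpha.
pose C := B ^+ 2 / (c `^ e * (cq ^+ 2 * q)).
have C0 : 0 <= C by rewrite divr_ge0 ?sqr_ge0// !mulr_ge0 ?powR_ge0 ?sqr_ge0// ltW.
have psiC t : t1 <= t -> psi t <= C * (T t * dT t * g t ^+ 2).
  move=> t1t; have t0t : t0 < t by exact: lt_le_trans t1t.
  have h1 : c `^ e * t `^ e <= u t `^ (2 * q - 1).
    by rewrite eE; apply: cP => //; rewrite subr_ge0 mulrC -ler_pdivrMr.
  have lp : 0 < lam t `^ q^-1 by rewrite powR_gt0// lam_gt0// ltW.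
  (* The gradient norm decreases, so [lam^(-1/q) <= B]; writing [l^-1 = l^-2 l] recovers the factor
     [lam^(1/q)] present in [dT]. *)
  have h2 : lam t `^ (- q^-1) <= B ^+ 2 * lam t `^ q^-1.
    have : lam t `^ (- q^-1) <= B.
      rewrite -closed_loop_gradX ?(ltW t0t)//.
      apply: ge0_ler_powR => //; rewrite ?nnegrE// -ler_sqr ?nnegrE//.
      exact: (flow_grad_nonincreasing ipP fA dT_gt0 yD').
    rewrite powRN; set l := lam t `^ q^-1 => lB.
    have -> : l^-1 = l^-1 ^+ 2 * l by field; rewrite gt_eqF.
    by rewrite ler_pM2r// ler_sqr ?nnegrE ?powR_ge0 ?invr_ge0 ?(ltW lp).
  have uu : T t * dT t = cq ^+ 2 * q * (u t `^ (2 * q - 1) * lam t `^ q^-1).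
    have -> : 2 * q - 1 = q + (q - 1) by ring.
    have ut : u t != 0 by rewrite gt_eqF.
    by rewrite (@powRD _ (u t) q (q - 1)) ?ut ?implybT// TE /dT; ring.
  have ce : 0 < c `^ e by rewrite powR_gt0.
  have -> : C * (T t * dT t * g t ^+ 2) =
      u t `^ (2 * q - 1) / c `^ e * (g t * g t * (B ^+ 2 * lam t `^ q^-1)).
    by rewrite uu /C; field; rewrite !gt_eqF.
  apply: ler_pM; rewrite ?powR_ge0 ?mulr_ge0 ?powR_ge0//.
    by rewrite ler_pdivlMr// mulrC.
  by rewrite ler_wpM2l// mulr_ge0.
pose F t := \int[mu]_(r in `[t0, t]) psi r.
apply: (@integral_ray_lty _ psi t0 t1 (F t1 + C * flow_energy f T y xs t1)) => //.
move=> t t1t; rewrite -/(F t).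
(* The energy is nonnegative, so it remains to see that this sum does not increase after [t1]. *)
suff : F t + C * flow_energy f T y xs t <= F t1 + C * flow_energy f T y xs t1.
  apply: le_trans; rewrite lerDl mulr_ge0//.
  by apply: (flow_energy_ge0 y T_gt0 xsP); exact: lt_le_trans t1t.
have /choice[dE dEP] : forall x, exists d, t0 < x ->
    is_derive x 1 (flow_energy f T y xs) d /\ d <= - (T x * dT x * g x ^+ 2).
  move=> x; have [t0x|_] := ltP t0 x; last by exists 0.
  by have [d ? ?] := flow_energy_derive ipP fA dT_gt0 TD yD' xsP t0x; exists d.
apply: (is_derive_le0_nonincreasing t1t
  (f := fun x => F x + C * flow_energy f T y xs x)
  (df := fun x => psi x + C * dE x)) => x /andP[t1x _].
  have t0x : t0 < x by exact: lt_le_trans t1x.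
  have [dEx _] := dEP _ t0x.
  exact: is_deriveD (is_derive_primitive t0x psic) (is_deriveZ C dEx).
have t0x : t0 < x by exact: lt_le_trans t1x.
have [_ dEx] := dEP _ t0x.
apply: le_trans (lerD (psiC _ t1x) (ler_wpM2l C0 dEx)) _.
by rewrite mulrN subrr.
Qed.

Lemma closed_loop_weak_cvg : exists2 xs, argmin f xs & weak_cvg_pinfty ip y xs.
Proof.
exact: (flow_weak_cvg ipP fA dT_gt0 TD yD' closed_loop_tau_pinfty).
Qed.

End ClosedLoop.

Theorem mainTheorem5 (R : realType) (H : completeNormedModType R)
  (ip : H -> H -> R) (f : H -> R) (gf : H -> H)
  (t0 q p : R) (y dy : R -> H) (lam : R -> R) :
  is_inner_product ip ->
  assumption_A ip f gf ->
  0 < t0 -> 1 / 2 <= q -> 1 <= p ->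
  (* y is continuously differentiable on [t0, +oo[ with derivative dy *)
  (forall t, t0 < t -> is_derive t 1 y (dy t)) ->
  {within `[t0, +oo[, continuous y} ->
  {within `[t0, +oo[, continuous dy} ->
  (* lambda : [t0, +oo[ -> ]0, +oo[ continuous *)
  (forall t, t0 <= t -> 0 < lam t) ->
  {within `[t0, +oo[, continuous lam} ->
  (* the system *)
  (forall t, t0 < t -> dy t + derive1 (tau t0 q lam) t *: gf (y t) = 0) ->
  (forall t, t0 <= t -> lam t `^ p * `|gf (y t)| `^ (p - 1) = 1) ->
  [/\ (fun t => (f (y t) - inf (range f)) * t `^ (p * q)) @ +oo --> 0,
      (fun t => `|gf (y t)| * t `^ (p * q)) @ +oo --> 0,
      (\int[lebesgue_measure]_(t in `[t0, +oo[)
          (t `^ (p * q * (2 - q^-1)) * `|gf (y t)| `^ (2 + (p - 1) / (p * q)))%:E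
        < +oo)%E &
      exists2 xs : H, argmin f xs & weak_cvg_pinfty ip y xs].

Proof.
move=> ipP fA t0_gt0 q_ge p_ge1 yD yc _ lam_gt0 lamc flow loop; split.
- exact: (closed_loop_value ipP fA t0_gt0 q_ge p_ge1 yD lam_gt0 lamc flow loop).
- exact: (closed_loop_grad ipP fA t0_gt0 q_ge p_ge1 yD lam_gt0 lamc flow loop).
- exact: (closed_loop_integral ipP fA t0_gt0 q_ge p_ge1 yD yc lam_gt0 lamc flow loop).
- exact: (closed_loop_weak_cvg ipP fA t0_gt0 q_ge p_ge1 yD lam_gt0 lamc flow loop).
Qed.
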